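(* Let $m\ge3$ be an odd integer, $M=\mathrm{diag}(2,m)$, and $n\in\mathbb{N}$, $n\ge1$. The mask $\mathbf{a}_{M,n}=\{\mathrm{a}_{M,n}(\boldsymbol{\alpha}):\boldsymbol{\alpha}\in\mathbb{Z}^2\}$ of the anisotropic interpolatory subdivision scheme $\mathcal{S}_{\mathbf{a}_{M,n}}$ of order $n$ and dilation matrix $M$ satisfies: (i) $\mathbf{a}_{M,n}$ has support $$\{(\alpha_1,\alpha_2)\in\mathbb{Z}^2 : m|\alpha_1|+2|\alpha_2|\le 2mn-2+m\}\subset\{1-2n,\dots,2n-1\}\times\{1-mn,\dots,mn-1\};$$ (ii) $\mathbf{a}_{M,n}$ is symmetric, i.e. $\mathrm{a}_{M,n}(\alpha_1,\alpha_2)=\mathrm{a}_{M,n}(\alpha_1,-\alpha_2)=\mathrm{a}_{M,n}(-\alpha_1,\alpha_2)=\mathrm{a}_{M,n}(-\alpha_1,-\alpha_2)$ for all $(\alpha_1,\alpha_2)\in\mathbb{Z}^2$; (iii) $\mathcal{S}_{\mathbf{a}_{M,n}}$ (assumed convergent, as the notion of reproduction requires) reproduces polynomials up to degree $2n-1$.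
   Context: For integers $r\ge2$ and $k\ge1$, the symbol of the univariate $(2k)$-point Dubuc–Deslauriers interpolatory subdivision scheme of dilation $r$ is the Laurent polynomial $$a_{r,k}(z)=1+\sum_{\varepsilon=1}^{r-1}\sum_{\beta=-k+1}^{k}\frac{(-1)^{\beta+k}}{(2k-1)!\,(\varepsilon/r-\beta)}\binom{2k-1}{k-\beta}\Bigl(-k+1-\frac{\varepsilon}{r}\Bigr)_{2k}\,z^{-r\beta+\varepsilon},\qquad z\in\mathbb{C}\setminus\{0\},$$ where $(x)_0=1$ and $(x)_\ell=x(x+1)\cdots(x+\ell-1)$. The anisotropic interpolatory subdivision scheme $\mathcal{S}_{\mathbf{a}_{M,n}}$ of order $n$ and dilation matrix $M=\mathrm{diag}(2,m)$ is defined by its symbol $$a_{M,n}(z_1,z_2)=\sum_{k=0}^{n-1}a_{2,n-k}(z_1)\,a_{m,k+1}(z_2)-\sum_{k=0}^{n-2}a_{2,n-k-1}(z_1)\,a_{m,k+1}(z_2),\qquad (z_1,z_2)\in(\mathbb{C}\setminus\{0\})^2,$$ and its mask $\mathbf{a}_{M,n}$ is given by the coefficients: $a_{M,n}(z_1,z_2)=\sum_{\boldsymbol{\alpha}\in\mathbb{Z}^2}\mathrm{a}_{M,n}(\boldsymbol{\alpha})\,z_1^{\alpha_1}z_2^{\alpha_2}$. For a finitely supported real mask $\mathbf{p}$ on $\mathbb{Z}^2$, the subdivision operator with dilation $M$ is $(\mathcal{S}_{\mathbf{p}}\mathbf{c})(\boldsymbol{\alpha})=\sum_{\boldsymbol{\beta}\in\mathbb{Z}^2}\mathrm{p}(\boldsymbol{\alpha}-M\boldsymbol{\beta})\mathrm{c}(\boldsymbol{\beta})$.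 The scheme is convergent if for every $\mathbf{c}\in\ell^\infty(\mathbb{Z}^2)$ there is a uniformly continuous function $F_{\mathbf{c}}:\mathbb{R}^2\to\mathbb{R}$ with $\lim_{k\to\infty}\sup_{\boldsymbol{\alpha}\in\mathbb{Z}^2}|F_{\mathbf{c}}(M^{-k}\boldsymbol{\alpha})-(\mathcal{S}_{\mathbf{p}}^k\mathbf{c})(\boldsymbol{\alpha})|=0$. The basic limit function is $\phi=F_{\boldsymbol{\delta}}$ with $\boldsymbol{\delta}(\boldsymbol{\alpha})=1$ if $\boldsymbol{\alpha}=\mathbf{0}$ and $0$ otherwise; it is compactly supported. Let $\Pi_N$ be the space of bivariate polynomials of total degree at most $N$. A convergent scheme reproduces polynomials up to degree $N$ (with respect to the parameter values $M^{-k}\boldsymbol{\alpha}$, i.e. shift parameter $\boldsymbol{\tau}=\mathbf{0}$, used for symmetric or interpolatory schemes) if for every $\pi\in\Pi_N$ one has $\sum_{\boldsymbol{\alpha}\in\mathbb{Z}^2}\pi(\boldsymbol{\alpha})\,\phi(\cdot-\boldsymbol{\alpha})=\pi$.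
   Formalization: In (i), the diamond is not contained in the box (it contains (2n,0)) and is not exactly the support; what is proved instead is that the support of the mask is contained in the diamond and also in the box. *)

(* Defs.v *)
From mathcomp Require Import all_boot all_order all_algebra.
From mathcomp Require Import all_classical all_reals all_analysis.
From mathcomp Require Import complex.
(* importing everything from mpoly clashes with the notations of analysis *)
From mathcomp Require mpoly.
Import (canonicals, coercions) mpoly.

Set Implicit Arguments.
Unset Strict Implicit.
Unset Printing Implicit Defensive.

Import Order.TTheory GRing.Theory Num.Theory numFieldNormedType.Exports.
Local Open Scope classical_set_scope.
Local Open Scope ring_scope.
Local Open Scope complex_scope.

Notation Z2 := 'cV[int]_2.

Definition vec2 {T : zmodType} (x y : T) : 'cV[T]_2 := \col_(i < 2) [:: x; y]`_i.

Definition toR2 (R : realType) (alpha : Z2) : 'cV[R]_2 :=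
  map_mx (fun t : int => t%:~R) alpha.

Section Symbols.
Context {F : fieldType}.

Definition pochhammer (x : F) (l : nat) : F := \prod_(i < l) (x + i%:R).

(* The index beta runs over -k+1, ..., k, as beta = i - k + 1 with i < 2k. *)
Definition DD_symbol (r k : nat) (z : F) : F :=
  1 + \sum_(1 <= eps < r) \sum_(i < 2 * k)
    let beta : int := i%:Z - k%:Z + 1 in
    (-1) ^ (beta + k%:Z)
      / ((2 * k - 1)`!%:R * (eps%:R / r%:R - beta%:~R))
      * 'C(2 * k - 1, `|k%:Z - beta|)%:R
      * pochhammer (- k%:R + 1 - eps%:R / r%:R) (2 * k)
      * z ^ (- (r%:Z * beta) + eps%:Z).

Definition aniso_symbol (m n : nat) (z1 z2 : F) : F :=
  \sum_(k < n) DD_symbol 2 (n - k) z1 * DD_symbol m k.+1 z2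
  - \sum_(k < n.-1) DD_symbol 2 (n - k - 1) z1 * DD_symbol m k.+1 z2.

End Symbols.

Section Masks.
Context {R : realType}.

Definition mask_support (p : Z2 -> R) : set Z2 := [set alpha | p alpha != 0].

Definition is_mask_of (s : R[i] -> R[i] -> R[i]) (p : Z2 -> R) : Prop :=
  finite_set (mask_support p) /\
  forall z1 z2 : R[i], z1 != 0 -> z2 != 0 ->
    s z1 z2 = \sum_(alpha \in mask_support p)
                (p alpha)%:C * z1 ^ (alpha 0 0) * z2 ^ (alpha 1 0).

(* The coefficients of a Laurent polynomial are unique, so the choice is
   immaterial; for an s that is not a real Laurent polynomial this is 0. *)
Definition mask_of (s : R[i] -> R[i] -> R[i]) : Z2 -> R :=
  xget (fun=> 0) [set p | is_mask_of s p].

End Masks.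

Definition aniso_dilation (m : nat) : 'M[int]_2 :=
  diag_mx (\row_(i < 2) [:: 2; m%:Z]`_i).

Definition aniso_mask (R : realType) (m n : nat) : Z2 -> R :=
  mask_of (@aniso_symbol R[i] m n).

Section Subdivision.
Context {R : realType}.
Implicit Types (M : 'M[int]_2) (p c : Z2 -> R).

Definition subdivision M p c : Z2 -> R :=
  fun alpha => \sum_(beta \in [set: Z2]) p (alpha - M *m beta) * c beta.

Definition refine M (k : nat) (alpha : Z2) : 'cV[R]_2 :=
  invmx (map_mx (fun t : int => t%:~R) M) ^+ k *m toR2 R alpha.

(* F is F_c; the supremum is taken in the extended reals. *)
Definition is_limit_function M p c (F : 'cV[R]_2 -> R) : Prop :=
  unif_continuous F /\
  (fun k : nat => ereal_sup (range (fun alpha : Z2 =>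
     `|F (refine M k alpha) - iter k (subdivision M p) c alpha|%:E)))
    @ \oo --> 0%:E.

Definition convergent_scheme M p : Prop :=
  forall c, bounded_fun c -> exists F, is_limit_function M p c F.

Definition delta : Z2 -> R := fun alpha => (alpha == 0)%:R.

Definition is_basic_limit_function M p (phi : 'cV[R]_2 -> R) : Prop :=
  is_limit_function M p delta phi.

Definition eval2 (pi : mpoly.mpoly 2 R) (x : 'cV[R]_2) : R :=
  mpoly.meval (fun i => x i 0) pi.

(* mpoly.msize is the total degree plus one. The sum over Z^2 is the finitely
   supported one: phi is compactly supported when p has finite support. The
   function phi is unique, and exists when the scheme converges. *)
Definition reproduces_polynomials M p (N : nat) : Prop :=
  exists2 phi, is_basic_limit_function M p phi &
    forall pi : mpoly.mpoly 2 R, (mpoly.msize pi <= N.+1)%N ->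
      forall x : 'cV[R]_2,
        \sum_(alpha \in [set: Z2]) eval2 pi (toR2 R alpha) * phi (x - toR2 R alpha)
        = eval2 pi x.

End Subdivision.

(* Main.v *)
Require Import Defs.
From mathcomp Require Import all_boot all_order all_algebra.
From mathcomp Require Import all_classical all_reals all_analysis.
From mathcomp Require Import complex qpoly ring lra zify.
From mathcomp Require mpoly.
Import (canonicals, coercions) mpoly.
Import Order.TTheory GRing.Theory Num.Theory numFieldNormedType.Exports.
Local Open Scope classical_set_scope.
Local Open Scope ring_scope.

Set Implicit Arguments.
Unset Strict Implicit.
Unset Printing Implicit Defensive.

(** The coefficient of the Dubuc-Deslauriers symbol at the exponent
    - r beta + eps is the value at eps / r of the Lagrange basis polynomial of
    the node beta among the nodes 1 - k, ..., k (dd_coefficientE).  Read this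
    way, the univariate mask has support in the open interval ]- rk, rk[, it is
    even because beta |-> 1 - beta, eps |-> r - eps reflects the interpolation
    problem, and it maps the samples of a polynomial of degree less than 2k on
    the integers to its samples on the integers divided by r
    (dd_mask_monomial).

    The anisotropic mask is the combination of tensor products of univariate
    masks given by aniso_coef: Laurent polynomials have unique coefficients, so
    it is the mask of the symbol (aniso_maskE).  A product of the schemes of
    orders p and q lives on the open rectangle with half-sides 2p and mq, and
    p + q <= n + 1 for all products that occur; this gives the support, and
    evenness is inherited from the factors.

    For the reproduction of polynomials, let i + j < 2n.  The product of
    orders p and q acts exactly in the first variable if i < 2p and in the
    second if j < 2q.  One of the two holds as soon as n <= p + q, so the
    products of the two defects vanish and the alternating sum telescopes: the
    scheme maps the samples of x^i y^j on Z^2 to its samples on M^-1 Z^2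
    (aniso_coef_monomial).  By induction the k-th iterate T_k of the delta
    sequence satisfies
      sum over beta of T_k (alpha - M^k beta) beta^(i, j)
        = (M^-k alpha)^(i, j)
    (cascade_monomial).  Take for alpha the integer part of M^k x.  Convergence
    of the scheme and continuity of phi make T_k (alpha - M^k beta) tend to
    phi (x - beta) (basic_limit_cvg_cascade); the supports of the T_k, rescaled
    by M^-k, stay in one fixed box (cascade_supp), so the sum is over finitely
    many beta independent of k and the identity passes to the limit. *)

(** * Finite sums over the integers and over the lattice *)

Definition zrange (N : nat) : seq int :=
  [seq i%:Z - N%:Z | i <- iota 0 (2 * N).+1].

Lemma mem_zrange N a : (a \in zrange N) = (`|a|%N <= N)%N.
Proof.
apply/mapP/idP => [[j] |aN].
  by rewrite mem_iota add0n => /andP[_ jN] ->; lia.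
exists (absz (a + N%:Z)); last by lia.
by rewrite mem_iota; lia.
Qed.

Lemma zrange_uniq N : uniq (zrange N).
Proof. by rewrite map_inj_uniq ?iota_uniq // => i j; lia. Qed.

(** Extraction of a coefficient; it turns every formal exponent of a symbol into
    an entry of its mask and back. *)
Lemma sum_zrange_delta (V : pzSemiRingType) N e (F : int -> V) :
  (`|e|%N <= N)%N -> \sum_(a <- zrange N) (a == e)%:R * F a = F e.
Proof.
move=> eN; rewrite (bigD1_seq e) ?zrange_uniq ?mem_zrange //=.
rewrite eqxx mul1r big1 ?addr0 // => a /negPf ->; exact: mul0r.
Qed.

Lemma vec20 (T : zmodType) (x y : T) : vec2 x y 0 0 = x.
Proof. by rewrite mxE. Qed.

Lemma vec21 (T : zmodType) (x y : T) : vec2 x y 1 0 = y.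
Proof. by rewrite mxE. Qed.

Lemma col2P (T : Type) (u v : 'cV[T]_2) :
  u 0 0 = v 0 0 -> u 1 0 = v 1 0 -> u = v.
Proof.
move=> e0 e1; apply/matrixP => i j; rewrite (ord1 j).
case: i => [[|[|i]] Hi] //=.
  by rewrite (_ : Ordinal Hi = 0) //; apply/val_inj.
by rewrite (_ : Ordinal Hi = 1) //; apply/val_inj.
Qed.

Lemma vec2E (T : zmodType) (u : 'cV[T]_2) : vec2 (u 0 0) (u 1 0) = u.
Proof. by apply: col2P; rewrite ?vec20 ?vec21. Qed.

(** Finitely supported sums over the lattice are computed on a square box of any
    sufficiently large size, where finite sums can be exchanged and split. *)
Definition in_box (N : nat) (alpha : Z2) : bool :=
  (absz (alpha 0%R 0%R) <= N)%N && (absz (alpha 1%R 0%R) <= N)%N.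

Definition box (N : nat) : seq Z2 :=
  [seq vec2 x y | x <- zrange N, y <- zrange N].

Lemma mem_box N alpha : (alpha \in box N) = in_box N alpha.
Proof.
apply/allpairsP/andP => [[[x y] /= [xN yN ->]] |[xN yN]].
  by rewrite vec20 vec21 -!mem_zrange.
by exists (alpha 0%R 0%R, alpha 1%R 0%R); rewrite !mem_zrange vec2E.
Qed.

Lemma box_uniq N : uniq (box N).
Proof.
apply: allpairs_uniq; rewrite ?zrange_uniq // => -[x y] [x' y'] _ _ /= e.
have := congr1 (fun v : Z2 => v 0 0) e; have := congr1 (fun v : Z2 => v 1 0) e.
by rewrite !vec20 !vec21 => -> ->.
Qed.

Lemma fsum_box (V : zmodType) N (P : set Z2) (f : Z2 -> V) :
  (forall alpha, P alpha -> in_box N alpha) ->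
  (forall alpha, ~ P alpha -> f alpha = 0) ->
  \sum_(alpha \in P) f alpha = \sum_(alpha <- box N) f alpha.
Proof.
move=> PN fP; rewrite (fsbig_seq _ _ (box_uniq N)); apply: fsbig_widen.
- by move=> alpha /PN; rewrite /= mem_box.
- by move=> alpha [_ /= /fP].
Qed.

Lemma fsumT_box (V : zmodType) N (f : Z2 -> V) :
  (forall alpha, ~~ in_box N alpha -> f alpha = 0) ->
  \sum_(alpha \in [set: Z2]) f alpha = \sum_(alpha <- box N) f alpha.
Proof.
move=> fN; rewrite (fsbig_seq _ _ (box_uniq N)); apply/esym/fsbig_widen => //.
by move=> alpha [_ /=]; rewrite mem_box => /negP /fN.
Qed.

Lemma sum_box (V : nmodType) N (F : Z2 -> V) :
  \sum_(alpha <- box N) F alpha =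
  \sum_(x <- zrange N) \sum_(y <- zrange N) F (vec2 x y).
Proof. by rewrite big_allpairs_dep. Qed.

Lemma sum_box_tensor (V : pzSemiRingType) N (f g : int -> V) :
  \sum_(alpha <- box N) f (alpha 0 0) * g (alpha 1 0) =
  (\sum_(x <- zrange N) f x) * (\sum_(y <- zrange N) g y).
Proof.
rewrite sum_box mulr_suml; apply: eq_bigr => x _; rewrite mulr_sumr.
by apply: eq_bigr => y _; rewrite vec20 vec21.
Qed.

(** * Uniqueness of the coefficients of a Laurent polynomial *)

(** Multiplied by the N-th power of the variable, the sum becomes a polynomial of
    degree at most 2N that vanishes at 1, ..., 2N + 1. *)
Lemma laurent_coef_eq0 (F : numFieldType) N (c : int -> F) :
  (forall z, z != 0 -> \sum_(a <- zrange N) c a * z ^ a = 0) ->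
  forall a, a \in zrange N -> c a = 0.
Proof.
move=> c0; pose p := \poly_(i < (2 * N).+1) c (i%:Z - N%:Z).
have p0 : p = 0.
  apply/eqP; apply: contraT => /max_poly_roots.
  move=> /(_ [seq i%:R | i <- iota 1 (2 * N).+1]).
  rewrite size_map size_iota => H.
  suff: ((2 * N).+1 < size p)%N.
    have := size_poly (2 * N).+1 (fun i => c (i%:Z - N%:Z)).
    by rewrite -/p; lia.
  apply: H; last first.
    by rewrite map_inj_uniq ?iota_uniq // => i j /eqP; rewrite eqr_nat => /eqP.
  apply/allP => z /mapP[j]; rewrite mem_iota => /andP[j_gt0 _] ->.
  have z0 : j%:R != 0 :> F by rewrite pnatr_eq0; lia.
  rewrite rootE horner_poly.
  rewrite -(big_mkord xpredT (fun i => c (i%:Z - N%:Z) * j%:R ^+ i)).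
  have := c0 _ z0; rewrite big_map => sum0; apply/eqP.
  transitivity (j%:R ^+ N *
      \sum_(i <- iota 0 (2 * N).+1) c (i%:Z - N%:Z) * j%:R ^ (i%:Z - N%:Z)).
    rewrite mulr_sumr /index_iota subn0; apply: eq_bigr => i _.
    rewrite mulrCA; congr (_ * _).
    by rewrite !exprnP -expfzDr //; congr (_ ^ _); lia.
  by rewrite sum0 mulr0.
move=> a /mapP[j]; rewrite mem_iota add0n => /andP[_ jN] ->.
have := congr1 (fun q : {poly F} => q`_j) p0.
by rewrite coef_poly coef0 jN.
Qed.

(** The two variables are separated one at a time: for fixed second variable
    the coefficients in the first one are themselves Laurent polynomials. *)
Lemma laurent2_coef_eq0 (F : numFieldType) N (c : Z2 -> F) :
  (forall z1 z2, z1 != 0 -> z2 != 0 ->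
    \sum_(alpha <- box N)
       c alpha * z1 ^ (alpha 0 0) * z2 ^ (alpha 1 0) = 0) ->
  forall alpha, in_box N alpha -> c alpha = 0.
Proof.
move=> c0 alpha /andP[alphaN0 alphaN1]; rewrite -(vec2E alpha).
have c2 z2 : z2 != 0 -> forall x, x \in zrange N ->
    \sum_(y <- zrange N) c (vec2 x y) * z2 ^ y = 0.
  move=> z2_neq0; apply: laurent_coef_eq0 => z1 z1_neq0.
  rewrite -[RHS](c0 z1 z2 z1_neq0 z2_neq0) sum_box; apply: eq_bigr => x _.
  rewrite mulr_suml; apply: eq_bigr => y _.
  by rewrite vec20 vec21 mulrAC.
apply: (laurent_coef_eq0 (N := N) (c := fun y => c (vec2 (alpha 0 0) y))).
  by move=> z2 z2_neq0; apply: c2 => //; rewrite mem_zrange.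
by rewrite mem_zrange.
Qed.

Section MaskOf.
Local Open Scope complex_scope.
Variable R : realType.
Implicit Types (s : R[i] -> R[i] -> R[i]) (p q : Z2 -> R).

Lemma finite_mask_box p : finite_set (mask_support p) ->
  exists N, forall alpha, ~~ in_box N alpha -> p alpha = 0.
Proof.
move=> /finite_seqP[e supp_e].
exists (\max_(alpha <- e) maxn (absz (alpha 0%R 0%R)) (absz (alpha 1%R 0%R))).
move=> alpha; apply: contraNeq => p_neq0.
have alpha_e : alpha \in e.
  suff : [set` e] alpha by [].
  by rewrite -supp_e.
rewrite /in_box -geq_max.
exact: (@leq_bigmax_seq _ e xpredT (fun alpha : Z2 =>
  maxn (absz (alpha 0%R 0%R)) (absz (alpha 1%R 0%R)))).
Qed.

Lemma box_supported_finite p N :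
  (forall alpha, ~~ in_box N alpha -> p alpha = 0) ->
  finite_set (mask_support p).
Proof.
move=> pN; apply: (@sub_finite_set _ _ [set` box N]); last exact: finite_seq.
by move=> alpha /= /eqP p_neq0; rewrite mem_box; apply: contraT => /pN.
Qed.

Lemma mask_symbol_box p N z1 z2 :
  (forall alpha, ~~ in_box N alpha -> p alpha = 0) ->
  \sum_(alpha \in mask_support p)
     (p alpha)%:C * z1 ^ (alpha 0 0) * z2 ^ (alpha 1 0) =
  \sum_(alpha <- box N) (p alpha)%:C * z1 ^ (alpha 0 0) * z2 ^ (alpha 1 0).
Proof.
move=> pN; apply: fsum_box => alpha.
- by move=> /eqP p_neq0; apply: contraT => /pN.
- by move=> /negP; rewrite negbK => /eqP ->; rewrite !mul0r.
Qed.

Lemma is_mask_of_uniq s p q : is_mask_of s p -> is_mask_of s q -> p = q.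
Proof.
move=> [pfin ps] [qfin qs].
have [N pN] := finite_mask_box pfin; have [N' qN] := finite_mask_box qfin.
have wider M M' alpha : (M <= M')%N -> ~~ in_box M' alpha -> ~~ in_box M alpha.
  by rewrite /in_box; lia.
pose B := maxn N N'.
have pB alpha : ~~ in_box B alpha -> p alpha = 0.
  by move=> /(wider N _ _ (leq_maxl _ _)) /pN.
have qB alpha : ~~ in_box B alpha -> q alpha = 0.
  by move=> /(wider N' _ _ (leq_maxr _ _)) /qN.
apply/funext => alpha; case: (boolP (in_box B alpha)) => [alphaB|alphaB].
  apply/eqP; rewrite -subr_eq0; apply/eqP/complexI.
  apply: (laurent2_coef_eq0 (N := B) (c := fun a => (p a - q a)%:C)) => //.
  move=> z1 z2 z1_neq0 z2_neq0; have := ps _ _ z1_neq0 z2_neq0.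
  rewrite (qs _ _ z1_neq0 z2_neq0) !(mask_symbol_box _ _ qB, mask_symbol_box _ _ pB).
  move=> /esym/eqP; rewrite -subr_eq0 -sumrB => /eqP; apply: etrans.
  by apply: eq_bigr => a _; rewrite rmorphB /= !mulrBl.
by rewrite pB ?qB.
Qed.

(** Thanks to uniqueness, exhibiting the coefficients of a symbol determines
    the chosen mask. *)
Lemma mask_of_eq s p : is_mask_of s p -> mask_of s = p.
Proof. by move=> sp; apply: xget_unique => // q /is_mask_of_uniq; apply. Qed.

End MaskOf.

(** * Lagrange weights *)

Definition dd_node (k j : nat) : int := j%:Z - k%:Z + 1.

Section LagrangeWeights.
Variable F : numFieldType.
Implicit Types (k : nat) (x : F).

Definition lagrange_weight k (i : 'I_(2 * k)) x : F :=
  \prod_(j < 2 * k | j != i)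
     ((x - (dd_node k j)%:~R) / ((dd_node k i)%:~R - (dd_node k j)%:~R)).

Lemma lagrange_weight_interpolation k (q : {poly F}) x :
  (0 < k)%N -> (size q <= 2 * k)%N ->
  \sum_(i < 2 * k) lagrange_weight i x * q.[(dd_node k i)%:~R] = q.[x].
Proof.
move=> k_gt0 szq.
have node_inj : injective (fun j : nat => (dd_node k j)%:~R : F).
  by move=> j l /eqP; rewrite eqr_int /dd_node => /eqP; lia.
have k2_gt0 : (0 < 2 * k)%N by rewrite muln_gt0.
rewrite [in RHS](lagrange_gen k2_gt0 node_inj szq) horner_sum.
apply: eq_bigr => i _; rewrite hornerM hornerC mulrC; congr (_ * _).
rewrite lagrangeE //= hornerM hornerC !horner_prod mulrC -prodf_div.
by apply: eq_bigr => j _; rewrite !hornerXsubC.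
Qed.

(** The reflection t |-> 1 - t permutes the nodes; it is what makes the mask
    even. *)
Lemma lagrange_weight_rev k (i : 'I_(2 * k)) x :
  lagrange_weight (rev_ord i) (1 - x) = lagrange_weight i x.
Proof.
have node_rev (j : 'I_(2 * k)) : dd_node k (rev_ord j) = 1 - dd_node k j.
  by have := ltn_ord j; rewrite /dd_node /=; lia.
rewrite /lagrange_weight (reindex_inj rev_ord_inj) /=.
apply: eq_big => [j|j _]; first by rewrite (inj_eq rev_ord_inj).
rewrite [dd_node k (_ - j.+1)]node_rev [dd_node k (_ - i.+1)]node_rev.
rewrite !rmorphB /= -mulrNN -invrN.
by congr (_ / _); ring.
Qed.

(** The nodes are consecutive integers, so the Lagrange denominators are products
    of two factorials. *)
Lemma prod_nodes_diff n (i : 'I_n) :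
  \prod_(j < n | j != i) (i%:R - j%:R : F)
  = (-1) ^+ (n - i.+1) * (i`!)%:R * ((n - i.+1)`!)%:R.
Proof.
have fact_prodr m : (m`!)%:R = \prod_(0 <= l < m) (l.+1%:R : F).
  by rewrite fact_prod natr_prod big_add1.
rewrite -(big_mkord (fun j => j != i) (fun j => i%:R - j%:R : F)).
rewrite (@big_cat_nat _ _ _ i) //=; last exact: ltnW.
rewrite [X in _ * X]big_ltn_cond // eqxx /= -mulrA mulrCA.
congr (_ * _).
  rewrite [RHS]fact_prodr [RHS]big_nat_rev /=.
  rewrite big_nat_cond [RHS]big_nat_cond.
  apply: eq_big => [j|j].
    by rewrite andbT; lia.
  by move=> /andP[/andP[_ ji] _]; rewrite add0n -natrB 1?ltnW //; congr _%:R; lia.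
rewrite [X in _ = _ * X]fact_prodr -[in X in _ = X * _](subn0 (n - i.+1)%N).
rewrite -prodr_const_nat -big_split /=.
rewrite -[in LHS](add0n i.+1%N) big_addn.
rewrite big_nat_cond [RHS]big_nat_cond; apply: eq_big => [j|j _].
  by rewrite andbT; lia.
by rewrite addnS -!natr1 natrD; ring.
Qed.

(** The Pochhammer factor is the full nodal polynomial, up to an even number of
    signs; dividing it by one linear factor leaves a Lagrange numerator. *)
Lemma dd_coefficientE k (i : 'I_(2 * k)) x :
  let beta := dd_node k i in
  x != beta%:~R ->
  (-1) ^ (beta + k%:Z) / ((2 * k - 1)`!%:R * (x - beta%:~R))
    * 'C(2 * k - 1, `|k%:Z - beta|)%:R * pochhammer (- k%:R + 1 - x) (2 * k)
  = lagrange_weight i x.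
Proof.
move=> beta x_neq; have x_beta : x - beta%:~R != 0 by rewrite subr_eq0.
have ik := ltn_ord i.
have poch : pochhammer (- k%:R + 1 - x) (2 * k) =
    (x - beta%:~R) * \prod_(j < 2 * k | j != i) (x - (dd_node k j)%:~R).
  transitivity (\prod_(j < 2 * k) (x - (dd_node k j)%:~R)); last first.
    by rewrite (bigD1 i).
  transitivity (\prod_(j < 2 * k) - (x - (dd_node k j)%:~R)).
    by apply: eq_bigr => j _; rewrite /dd_node !rmorphD /= rmorphN /=; ring.
  by rewrite prodrN card_ord exprM sqrrN !expr1n mul1r.
have denom : \prod_(j < 2 * k | j != i) (beta%:~R - (dd_node k j)%:~R : F) =
    (-1) ^+ (2 * k - i.+1) * (i`!)%:R * ((2 * k - i.+1)`!)%:R.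
  rewrite -prod_nodes_diff; apply: eq_bigr => j _.
  by rewrite /beta /dd_node !rmorphD /= !rmorphN /=; ring.
rewrite /lagrange_weight prodf_div -/beta denom poch.
have -> : (-1) ^ (beta + k%:Z) = (-1) ^+ (2 * k - i.+1) :> F.
  have -> : beta + k%:Z = i.+1%:Z by rewrite /beta /dd_node; lia.
  rewrite -exprnP -[LHS]signr_odd -[RHS]signr_odd; congr (_ ^+ _).
  by rewrite oddB // oddM.
have -> : absz (k%:Z - beta) = (2 * k - 1 - i)%N.
  by rewrite /beta /dd_node; lia.
have il : (i <= 2 * k - 1)%N by lia.
rewrite bin_sub // -(bin_fact il).
have -> : (2 * k - 1 - i = 2 * k - i.+1)%N by lia.
rewrite !natrM.
have f1 : (i`!)%:R != 0 :> F by rewrite pnatr_eq0 -lt0n fact_gt0.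
have f2 : ((2 * k - i.+1)`!)%:R != 0 :> F by rewrite pnatr_eq0 -lt0n fact_gt0.
have f3 : 'C(2 * k - 1, i)%:R != 0 :> F by rewrite pnatr_eq0 -lt0n bin_gt0; lia.
rewrite -signr_odd; case: odd; field; by rewrite f1 f2 f3 x_beta.
Qed.

End LagrangeWeights.

(** * The univariate masks *)

Section UnivariateMask.
Variable F : numFieldType.
Implicit Types (r k : nat) (alpha : int).

(** A sum over the terms of the symbol rather than a definition by cases on the
    residue of alpha modulo r: sums against the mask collapse term by term. *)
Definition dd_mask r k alpha : F :=
  (alpha == 0)%:R +
  \sum_(1 <= eps < r) \sum_(i < 2 * k)
    (alpha == - (r%:Z * dd_node k i) + eps%:Z)%:R
      * lagrange_weight i (eps%:R / r%:R).

Lemma dd_exponent_bound r k eps (i : 'I_(2 * k)) :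
  (1 <= eps < r)%N ->
  (absz (- (r%:Z * dd_node k i) + eps%:Z)%R < r * k)%N.
Proof.
move=> eps_r; have := ltn_ord i; rewrite /dd_node => ik.
have : 0 <= r%:Z * i%:Z <= r%:Z * (2 * k%:Z - 1).
  by apply/andP; split; [rewrite mulr_ge0 | rewrite ler_wpM2l //; lia].
move: eps_r => /andP[eps_gt0 eps_r]; nia.
Qed.

Lemma dd_mask_supp r k alpha :
  (0 < r)%N -> (0 < k)%N -> dd_mask r k alpha != 0 -> (absz alpha < r * k)%N.
Proof.
move=> r_gt0 k_gt0; rewrite ltnNge; apply: contra => alpha_big.
rewrite /dd_mask big_nat big1 => [|eps eps_r].
  by rewrite (_ : alpha == 0 = false) ?addr0 //; apply/eqP; nia.
rewrite big1 // => i _; have := dd_exponent_bound i eps_r.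
case: eqP => [<-|_ _]; last by rewrite mul0r.
by rewrite ltnNge alpha_big.
Qed.

(** Nonzero exponents are exchanged with their opposites by eps |-> r - eps
    together with the reflection of the nodes. *)
Lemma dd_mask_sym r k alpha : dd_mask r k (- alpha) = dd_mask r k alpha.
Proof.
rewrite /dd_mask oppr_eq0; congr (_ + _).
rewrite [RHS]big_nat_rev /= big_nat [RHS]big_nat; apply: eq_bigr => eps eps_r.
have /andP[eps_gt0 eps_ltr] := eps_r.
rewrite [RHS](reindex_inj rev_ord_inj); apply: eq_bigr => i _ /=.
have -> : (1 + r - eps.+1 = r - eps)%N by lia.
have -> : (r - eps)%:R / r%:R = 1 - eps%:R / r%:R :> F.
  by rewrite natrB ?(ltnW eps_ltr) // mulrBl divff // pnatr_eq0; lia.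
rewrite [lagrange_weight _ (1 - _)](lagrange_weight_rev i).
congr (_%:R * _); congr nat_of_bool.
have := ltn_ord i; rewrite /dd_node => ik.
by apply/eqP/eqP; nia.
Qed.

(** Write alpha = r g + e with 0 <= e < r.  If e = 0 only the coefficient 1
    contributes, with value g^d; otherwise only the residue eps = e does, at
    beta = g + node, and the sum is the interpolation of (g + t)^d at t = e/r. *)
Lemma dd_mask_monomial r k d N alpha :
  (1 < r)%N -> (0 < k)%N -> (d < 2 * k)%N -> (absz alpha + k < N)%N ->
  \sum_(beta <- zrange N) dd_mask r k (alpha - r%:Z * beta) * beta%:~R ^+ d
  = (alpha%:~R / r%:R) ^+ d.
Proof.
move=> r_gt1 k_gt0 dk alphaN.
have r_neq0 : r%:R != 0 :> F by rewrite pnatr_eq0; lia.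
pose g := (alpha %/ r%:Z)%Z; pose e := absz (alpha %% r%:Z)%Z.
have alphaE : alpha = r%:Z * g + e%:Z.
  rewrite {1}(divz_eq alpha r%:Z) mulrC /e gez0_abs //.
  by rewrite modz_ge0 //; lia.
have er : (e < r)%N.
  by have := ltz_mod alpha (d := r%:Z); rewrite /e; lia.
have gN : (absz g + k < N)%N.
  by move: alphaN; rewrite [X in absz X]alphaE; nia.
have alphaR : alpha%:~R / r%:R = g%:~R + e%:R / r%:R :> F.
  by rewrite alphaE rmorphD rmorphM /= mulrDl mulrAC divff // mul1r.
clearbody g e.
under eq_bigr do rewrite /dd_mask mulrDl mulr_suml.
rewrite big_split /= exchange_big /=.
have lattice b eps (i : 'I_(2 * k)) : (0 <= eps < r)%N ->
    (alpha - r%:Z * b == - (r%:Z * dd_node k i) + eps%:Z) =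
    (eps == e) && (b == g + dd_node k i).
  move=> /andP[_ eps_r]; rewrite alphaE; set c := dd_node k i.
  apply/eqP/andP => [H|[/eqP -> /eqP ->]]; last by ring.
  have : (eps%:Z - e%:Z) = r%:Z * (g - b + c) by move: H; lia.
  move=> H'; have : g - b + c = 0 by nia.
  by move=> h0; move: H'; rewrite h0 mulr0; split; apply/eqP; lia.
have integer b : (alpha - r%:Z * b == 0) = (e == 0%N) && (b == g).
  rewrite alphaE; apply/eqP/andP => [H|[/eqP -> /eqP ->]]; last by ring.
  have : - e%:Z = r%:Z * (g - b) by lia.
  move=> H'; have : g - b = 0 by nia.
  by move=> h0; move: H'; rewrite h0 mulr0; split; apply/eqP; lia.
have [e0|e_neq0] := eqVneq e 0%N.
  rewrite [X in _ + X]big_nat [X in _ + X]big1 => [|eps eps_r]; last first.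
    rewrite big1 // => b _; rewrite mulr_suml big1 // => i _.
    rewrite lattice; last by lia.
    by rewrite (_ : eps == e = false) ?mul0r //; lia.
  rewrite addr0 alphaR e0 mul0r addr0.
  rewrite -(sum_zrange_delta (N := N) (e := g) (fun b => b%:~R ^+ d)); last by lia.
  by apply: eq_bigr => b _; rewrite integer e0 eqxx.
rewrite big1 => [|b _]; last by rewrite integer (negPf e_neq0) mul0r.
rewrite add0r (bigD1_seq e) ?iota_uniq ?mem_index_iota //=; last by lia.
rewrite [X in _ + X]big_seq_cond [X in _ + X]big1 ?addr0; last first.
  move=> eps /andP[]; rewrite mem_index_iota => eps_r /negPf eps_e.
  rewrite big1 // => b _; rewrite mulr_suml big1 // => i _.
  by rewrite lattice ?eps_e ?mul0r //; lia.
under eq_bigr do rewrite mulr_suml.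
rewrite exchange_big /= alphaR.
have -> : (g%:~R + e%:R / r%:R) ^+ d = (('X - (- g%:~R)%:P) ^+ d).[e%:R / r%:R] :> F.
  by rewrite !hornerE opprK addrC.
rewrite -(lagrange_weight_interpolation _ k_gt0); last first.
  by rewrite size_exp_XsubC.
apply: eq_bigr => i _; rewrite !hornerE opprK [_ + g%:~R]addrC -rmorphD /=.
rewrite -(sum_zrange_delta (N := N) (e := g + dd_node k i)
  (fun b => lagrange_weight i (e%:R / r%:R) * b%:~R ^+ d)) /=.
  by apply: eq_bigr => b _; rewrite lattice ?eqxx /= ?mulrA //; lia.
by have := ltn_ord i; rewrite /dd_node; lia.
Qed.

End UnivariateMask.

(** * The univariate symbols *)

Lemma dd_mask_morph (F G : numFieldType) (f : {rmorphism F -> G}) r k alpha :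
  f (dd_mask F r k alpha) = dd_mask G r k alpha.
Proof.
rewrite /dd_mask rmorphD rmorph_nat rmorph_sum; congr (_ + _).
apply: eq_bigr => eps _; rewrite rmorph_sum; apply: eq_bigr => i _ /=.
rewrite rmorphM rmorph_nat rmorph_prod; congr (_ * _); apply: eq_bigr => j _.
by rewrite fmorph_div !rmorphB /= fmorph_div !rmorph_nat !rmorph_int.
Qed.

Lemma DD_symbolE (F : numFieldType) r k N (z : F) : (r * k <= N)%N ->
  DD_symbol r k z = \sum_(a <- zrange N) dd_mask F r k a * z ^ a.
Proof.
move=> rkN; under [RHS]eq_bigr do rewrite /dd_mask mulrDl mulr_suml.
rewrite big_split /=; congr (_ + _).
  by rewrite (sum_zrange_delta (fun a => z ^ a)).
rewrite [RHS]exchange_big /= big_nat [RHS]big_nat; apply: eq_bigr => eps eps_r.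
under [RHS]eq_bigr do rewrite mulr_suml.
rewrite [RHS]exchange_big /=; apply: eq_bigr => i _.
(* a node is an integer and 0 < eps < r, so no denominator vanishes *)
have eps_node : eps%:R / r%:R != (dd_node k i)%:~R :> F.
  have r_neq0 : r%:R != 0 :> F by rewrite pnatr_eq0; lia.
  rewrite -(inj_eq (mulIf r_neq0)) divfK // -[r%:R]/(r%:Z%:~R) -rmorphM /=.
  rewrite -[eps%:R]/(eps%:Z%:~R) eqr_int; apply/eqP => eps_mul.
  have /orP[node_le|node_ge] : (dd_node k i <= 0) || (1 <= dd_node k i) by lia.
    by nia.
  by nia.
rewrite -/(dd_node k i) dd_coefficientE //.
rewrite -(sum_zrange_delta (N := N) (e := - (r%:Z * dd_node k i) + eps%:Z)
  (fun a => lagrange_weight i (eps%:R / r%:R) * z ^ a)).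
  by apply: eq_bigr => a _; rewrite mulrA.
by have := dd_exponent_bound i eps_r; lia.
Qed.

(** * The anisotropic mask *)

Lemma aniso_dilationE m (beta : Z2) :
  aniso_dilation m *m beta = vec2 (2%:Z * beta 0 0) (m%:Z * beta 1 0).
Proof.
have lift1 : lift ord0 ord0 = 1 :> 'I_2 by apply/val_inj.
apply: col2P; rewrite !mxE !big_ord_recl big_ord0 !mxE /= !mulr0n mul0r.
  by rewrite !addr0.
by rewrite add0r addr0 lift1.
Qed.

(** One step of the scheme maps the samples of the monomial on the lattice to
    its samples on the refined lattice. *)
Definition refines_monomial (R : realType) m (a : Z2 -> R) i j : Prop :=
  forall alpha : Z2,
    \sum_(beta \in [set: Z2])
       a (alpha - aniso_dilation m *m beta)
         * ((beta 0 0)%:~R ^+ i * (beta 1 0)%:~R ^+ j)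
    = ((alpha 0 0)%:~R / 2%:R) ^+ i * ((alpha 1 0)%:~R / m%:R) ^+ j.

Section AnisotropicMask.
Variables (R : realType) (m n : nat).

Definition aniso_coef (alpha : Z2) : R :=
  \sum_(k < n) dd_mask R 2 (n - k) (alpha 0 0) * dd_mask R m k.+1 (alpha 1 0)
  - \sum_(k < n.-1)
      dd_mask R 2 (n - k - 1) (alpha 0 0) * dd_mask R m k.+1 (alpha 1 0).

(** Every summand is a tensor product of masks supported in
    ]-2p, 2p[ and ]-mq, mq[ with p + q at most n + 1. *)
Lemma aniso_coef_supp alpha : (1 < m)%N -> aniso_coef alpha != 0 ->
  exists p q, [/\ (0 < p <= n)%N, (0 < q <= n)%N, (p + q <= n.+1)%N,
    (absz (alpha 0%R 0%R) < 2 * p)%N & (absz (alpha 1%R 0%R) < m * q)%N].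
Proof.
move=> m_gt1; apply: contraTP => no_pq; rewrite negbK.
have term0 p q : (0 < p <= n)%N -> (0 < q <= n)%N -> (p + q <= n.+1)%N ->
    dd_mask R 2 p (alpha 0 0) * dd_mask R m q (alpha 1 0) = 0.
  move=> p_n q_n pq; apply/eqP/negPn/negP; rewrite mulf_eq0 negb_or.
  move=> /andP[/dd_mask_supp alpha0 /dd_mask_supp alpha1]; apply: no_pq.
  by exists p, q; split => //; [apply: alpha0 | apply: alpha1]; lia.
rewrite /aniso_coef !big1 ?subr0 // => k _; have := ltn_ord k => kn;
  by apply: term0; lia.
Qed.

Lemma aniso_coef_box alpha : (1 < m)%N ->
  ~~ in_box (2 * n + m * n) alpha -> aniso_coef alpha = 0.
Proof.
move=> m_gt1; apply: contraNeq => /(aniso_coef_supp m_gt1)[p [q [pn qn _ a0 a1]]].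
by rewrite /in_box; apply/andP; split; nia.
Qed.

Lemma is_mask_of_aniso_coef : (1 < m)%N ->
  is_mask_of (@aniso_symbol R[i] m n) aniso_coef.
Proof.
move=> m_gt1; split.
  exact: (@box_supported_finite _ _ (2 * n + m * n) (fun a => aniso_coef_box m_gt1)).
move=> z1 z2 _ _.
rewrite (mask_symbol_box _ _ (fun a => @aniso_coef_box a m_gt1)).
have tensor p q : (p <= n)%N -> (q <= n)%N ->
  DD_symbol 2 p z1 * DD_symbol m q z2 = \sum_(alpha <- box (2 * n + m * n))
    (dd_mask R 2 p (alpha 0 0) * dd_mask R m q (alpha 1 0))%:C%C
      * z1 ^ (alpha 0 0) * z2 ^ (alpha 1 0).
  move=> pn qn.
  rewrite (@DD_symbolE _ _ _ (2 * n + m * n)); last by nia.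
  rewrite (@DD_symbolE _ m _ (2 * n + m * n)); last by nia.
  rewrite -sum_box_tensor; apply: eq_bigr => alpha _.
  rewrite rmorphM /= !dd_mask_morph -!mulrA; congr (_ * _).
  by rewrite mulrCA.
under [RHS]eq_bigr do
  rewrite rmorphB /= !rmorph_sum /= !mulrBl !mulr_suml.
rewrite /aniso_symbol sumrB; congr (_ - _).
  by rewrite [RHS]exchange_big; apply: eq_bigr => k _; rewrite tensor //; lia.
rewrite [RHS]exchange_big; apply: eq_bigr => k _.
rewrite tensor //; first by lia.
exact: leq_trans (ltn_ord k) (leq_pred n).
Qed.

Lemma aniso_maskE : (1 < m)%N -> aniso_mask R m n = aniso_coef.
Proof. by move=> /is_mask_of_aniso_coef /mask_of_eq. Qed.

(** On a monomial the two univariate schemes take the values X + x_p and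
    Y + y_q, where XY is the wanted value, x_p vanishes when i < 2p and y_q when
    j < 2q.  As i + j < 2n, in each product one of the two defects vanishes, and
    the combination telescopes: it leaves XY + X y_n + x_n Y = XY. *)
Lemma aniso_coef_monomial i j : (1 < m)%N -> (i + j < 2 * n)%N ->
  refines_monomial m aniso_coef i j.
Proof.
move=> m_gt1 ij alpha.
have dil0 (beta : Z2) : (alpha - aniso_dilation m *m beta) 0 0
    = alpha 0 0 - 2%:Z * beta 0 0.
  by rewrite aniso_dilationE !mxE.
have dil1 (beta : Z2) : (alpha - aniso_dilation m *m beta) 1 0
    = alpha 1 0 - m%:Z * beta 1 0.
  by rewrite aniso_dilationE !mxE.
set x := alpha 0 0 in dil0 *; set y := alpha 1 0 in dil1 *.
pose N := (absz x + absz y + 2 * n + m * n).+1.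
rewrite (fsumT_box (N := N)) => [|beta betaN]; last first.
  have [->|] := eqVneq (aniso_coef (alpha - aniso_dilation m *m beta)) 0.
    by rewrite mul0r.
  move=> /(aniso_coef_supp m_gt1)[p [q [pn qn _]]]; rewrite dil0 dil1 => a0 a1.
  have mqn : (m * q <= m * n)%N by rewrite leq_mul2l; lia.
  have beta0 : (absz (beta 0%R 0%R) <= N)%N by move: a0; rewrite /N; lia.
  have beta1 : (absz (beta 1%R 0%R) <= N)%N.
    have : (absz (beta 1%R 0%R) <= absz (m%:Z * beta 1 0)%R)%N.
      by rewrite abszM leq_pmull //; lia.
    by move: a1; rewrite /N; lia.
  by move: betaN; rewrite /in_box beta0 beta1.
(* U p and V q are the two univariate schemes of orders p and q applied to the
   two factors of the monomial *)
pose U p := \sum_(b <- zrange N) dd_mask R 2 p (x - 2%:Z * b) * b%:~R ^+ i.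
pose V q := \sum_(b <- zrange N) dd_mask R m q (y - m%:Z * b) * b%:~R ^+ j.
pose X : R := (x%:~R / 2%:R) ^+ i; pose Y : R := (y%:~R / m%:R) ^+ j.
have UX p : (0 < p <= n)%N -> (i < 2 * p)%N -> U p = X.
  by move=> pn ip; apply: dd_mask_monomial; rewrite // /N; lia.
have VY q : (0 < q <= n)%N -> (j < 2 * q)%N -> V q = Y.
  by move=> qn jq; apply: dd_mask_monomial; rewrite // /N; nia.
transitivity (\sum_(k < n) U (n - k)%N * V k.+1
              - \sum_(k < n.-1) U (n - k - 1)%N * V k.+1).
  under eq_bigr do rewrite /aniso_coef mulrBl !mulr_suml.
  rewrite sumrB; congr (_ - _); rewrite exchange_big; apply: eq_bigr => k _;
    rewrite -sum_box_tensor; apply: eq_bigr => beta _;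
    by rewrite dil0 dil1 mulrACA.
(* the product of the defects U p - X and V q - Y vanishes *)
have UV p q : (0 < p <= n)%N -> (0 < q <= n)%N -> (n <= p + q)%N ->
    U p * V q = U p * Y + X * V q - X * Y.
  move=> pn qn pq; have [ip|ip] := ltnP i (2 * p)%N.
    by rewrite UX //; ring.
  by rewrite (VY q) //; [ring | lia].
have n_gt0 : (0 < n)%N by lia.
rewrite -/X -/Y.
have Un : U n = X by apply: UX; lia.
have Vn : V n = Y by apply: VY; lia.
have UV1 (k : 'I_n) : U (n - k)%N * V k.+1
    = U (n - k)%N * Y + X * V k.+1 - X * Y.
  by apply: UV; have := ltn_ord k; lia.
have UV2 (k : 'I_n.-1) : U (n - k - 1)%N * V k.+1
    = U (n - k - 1)%N * Y + X * V k.+1 - X * Y.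
  by apply: UV; have := ltn_ord k; lia.
rewrite (eq_bigr _ (fun k _ => UV1 k)) (eq_bigr _ (fun k _ => UV2 k)).
rewrite !sumrB !big_split /= -!mulr_suml -!mulr_sumr !sumr_const !card_ord.
have -> : \sum_(k < n) U (n - k)%N = X + \sum_(k < n.-1) U (n - k - 1)%N.
  case: n n_gt0 Un => // n' _ Un; rewrite big_ord_recl subn0 Un; congr (_ + _).
  by apply: eq_bigr => k _; congr U; rewrite /= /bump; lia.
have -> : \sum_(k < n) V k.+1 = \sum_(k < n.-1) V k.+1 + Y.
  by case: n n_gt0 Vn => // n' _ Vn; rewrite big_ord_recr Vn.
rewrite -[in X in _ *+ X](prednK n_gt0) mulrS; ring.
Qed.

End AnisotropicMask.

(** * Iterates of the subdivision operator on the delta sequence *)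

(** A sum with infinite support is 0 by convention, so the common box is what
    makes both iterated sums meaningful. *)
Lemma exchange_fsumT (V : zmodType) N (G : Z2 -> Z2 -> V) :
  (forall beta gamma, G beta gamma != 0 -> in_box N beta && in_box N gamma) ->
  \sum_(beta \in [set: Z2]) \sum_(gamma \in [set: Z2]) G beta gamma
  = \sum_(gamma \in [set: Z2]) \sum_(beta \in [set: Z2]) G beta gamma.
Proof.
move=> GN.
have Gl beta gamma : ~~ in_box N beta -> G beta gamma = 0.
  by apply: contraNeq => /GN /andP[].
have Gr beta gamma : ~~ in_box N gamma -> G beta gamma = 0.
  by apply: contraNeq => /GN /andP[].
rewrite (fsumT_box (N := N)); last by move=> b bN; apply: fsbig1 => c _; exact: Gl.
rewrite [RHS](fsumT_box (N := N)); last first.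
  by move=> c cN; apply: fsbig1 => b _; exact: Gr.
under eq_bigr => b _ do rewrite (fsumT_box (N := N) (Gr b)).
under [RHS]eq_bigr => c _ do rewrite (fsumT_box (N := N) (Gl^~ c)).
exact: exchange_big.
Qed.

Lemma fsum_neq0 (V : zmodType) (f : Z2 -> V) :
  \sum_(beta \in [set: Z2]) f beta != 0 -> exists beta, f beta != 0.
Proof.
move=> sum_neq0; apply: contrapT => none; move/eqP: sum_neq0; apply.
apply: fsbig1 => beta _; apply/eqP/negPn/negP => f_neq0.
by apply: none; exists beta.
Qed.

Lemma quotient_bound (s C N : nat) (x b : int) : (0 < s)%N ->
  (absz x <= C * s)%N -> (absz (x - s%:Z * b)%R <= N * s)%N ->
  (absz b <= C + N)%N.
Proof.
move=> s_gt0 xC xb; rewrite -(leq_pmul2r s_gt0) mulnDl.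
have -> : (absz b * s = absz (s%:Z * b)%R)%N by rewrite abszM mulnC.
by lia.
Qed.

Section Cascade.
Variables (R : realType) (m N : nat) (a : Z2 -> R).
Hypothesis m_gt1 : (1 < m)%N.
Hypothesis a_supp : forall alpha, a alpha != 0 -> in_box N alpha.

Definition cascade k : Z2 -> R :=
  iter k (subdivision (aniso_dilation m) a) (@delta R).

(** The action of the k-th power of the dilation matrix on the lattice. *)
Definition dilate k (beta : Z2) : Z2 :=
  vec2 ((2 ^ k)%N%:Z * beta 0 0) ((m ^ k)%N%:Z * beta 1 0).

(** The bound N (s^k - 1) on the support, unlike N s^k, propagates:
    N + s N (s^k - 1) <= N (s^(k+1) - 1) whenever s >= 2. *)
Lemma cascade_supp k alpha : cascade k alpha != 0 ->
  (absz (alpha 0%R 0%R) + N <= N * 2 ^ k)%N /\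
  (absz (alpha 1%R 0%R) + N <= N * m ^ k)%N.
Proof.
elim: k alpha => [|k IHk] alpha.
  rewrite /cascade /= /delta; case: (alpha =P 0) => [->|_]; last by rewrite eqxx.
  by rewrite !mxE !expn0 !muln1.
move=> /fsum_neq0[gamma]; rewrite mulf_eq0 negb_or => /andP[/a_supp].
rewrite /in_box aniso_dilationE !mxE /= => /andP[a0 a1] /IHk[c0 c1].
rewrite !expnS; split; first by nia.
by nia.
Qed.

(** A monomial is an eigenvector of the scheme up to rescaling, so the induction
    on k only multiplies the two rescaling factors; the shift of gamma by
    M^k beta brings the sum over beta into the form of the induction hypothesis. *)
Lemma cascade_monomial i j k alpha :
  refines_monomial m a i j ->
  \sum_(beta \in [set: Z2])
     cascade k (alpha - dilate k beta)
       * ((beta 0 0)%:~R ^+ i * (beta 1 0)%:~R ^+ j)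
  = ((alpha 0 0)%:~R / (2 ^ k)%N%:R) ^+ i
    * ((alpha 1 0)%:~R / (m ^ k)%N%:R) ^+ j.
Proof.
move=> a_monomial; elim: k alpha => [|k IHk] alpha.
  have d0 beta : dilate 0 beta = beta by rewrite /dilate !expn0 !mul1r vec2E.
  rewrite -(fsbig_widen [set alpha]) => [|//|beta [_ /= beta_neq]].
    by rewrite fsbig_set1 d0 /cascade /= /delta subrr eqxx mul1r !expn0 !divr1.
  rewrite d0 /cascade /= /delta subr_eq0 eq_sym.
  by case: eqP => [//|_]; rewrite mul0r.
transitivity (\sum_(beta \in [set: Z2]) \sum_(gamma \in [set: Z2])
   a (alpha - aniso_dilation m *m gamma) *
   (cascade k (gamma - dilate k beta)
       * ((beta 0 0)%:~R ^+ i * (beta 1 0)%:~R ^+ j))).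
  apply: eq_fsbigr => beta _.
  rewrite {1}/cascade iterS -/(cascade k) /subdivision.
  rewrite (reindex_fsbigT (fun gamma => gamma - dilate k beta)) /=; last first.
    by exists (fun gamma => gamma + dilate k beta) => gamma; rewrite ?subrK ?addrK.
  rewrite mulr_fsuml; apply: eq_fsbigr => gamma _; rewrite -mulrA.
  congr (a _ * _); apply: col2P;
    rewrite !aniso_dilationE !mxE /= ?expnS ?PoszM; ring.
(* a nonzero term forces |gamma| <= |alpha| + N, then |beta| <= |gamma| + N *)
pose B := (absz (alpha 0%R 0%R) + absz (alpha 1%R 0%R) + N + N)%N.
rewrite (exchange_fsumT (N := B)) => [|beta gamma]; last first.
  rewrite !mulf_eq0 !negb_or => /and3P[/a_supp + /cascade_supp + _].
  rewrite /in_box aniso_dilationE !mxE /= => /andP[a0 a1] [c0 c1].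
  have k2 : (0 < 2 ^ k)%N by rewrite expn_gt0.
  have km : (0 < m ^ k)%N by rewrite expn_gt0; lia.
  have m_gt0 : (0 < m)%N by lia.
  have g0 : (absz (gamma 0%R 0%R) <= absz (alpha 0%R 0%R) + N)%N.
    by apply: (@quotient_bound 2 _ _ _ _ _ _ (leq_trans a0 _)); rewrite // leq_pmulr.
  have g1 : (absz (gamma 1%R 0%R) <= absz (alpha 1%R 0%R) + N)%N.
    by apply: (quotient_bound m_gt0 _ (leq_trans a1 _)); rewrite leq_pmulr.
  have b0 : (absz (beta 0%R 0%R) <= absz (gamma 0%R 0%R) + N)%N.
    by apply: (quotient_bound k2 _ (leq_trans (leq_addr _ _) c0)); rewrite leq_pmulr.
  have b1 : (absz (beta 1%R 0%R) <= absz (gamma 1%R 0%R) + N)%N.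
    by apply: (quotient_bound km _ (leq_trans (leq_addr _ _) c1)); rewrite leq_pmulr.
  by rewrite /B; clear -g0 g1 b0 b1; apply/andP; split; apply/andP; split; lia.
under eq_fsbigr => gamma _ do rewrite -mulr_fsumr IHk.
transitivity ((((alpha 0 0)%:~R / 2%:R) ^+ i * ((alpha 1 0)%:~R / m%:R) ^+ j)
  * ((2 ^ k)%N%:R^-1 ^+ i * (m ^ k)%N%:R^-1 ^+ j) : R).
  rewrite -a_monomial mulr_fsuml; apply: eq_fsbigr => gamma _.
  by rewrite !exprMn; ring.
by rewrite !expnS !natrM !invfM !exprMn; ring.
Qed.

End Cascade.

(** * Passage to the limit *)

Section Refinement.
Variables (R : realType) (m : nat).
Hypothesis m_gt1 : (1 < m)%N.

Lemma refineE k (alpha : Z2) :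
  refine (R := R) (aniso_dilation m) k alpha =
  vec2 ((alpha 0 0)%:~R / (2 ^ k)%N%:R) ((alpha 1 0)%:~R / (m ^ k)%N%:R).
Proof.
rewrite /refine; set D := map_mx _ _.
have m_neq0 : m%:R != 0 :> R by rewrite pnatr_eq0; lia.
have lift1 : lift ord0 ord0 = 1 :> 'I_2 by apply/val_inj.
have DE (v : 'cV[R]_2) : D *m v = vec2 (2%:R * v 0 0) (m%:R * v 1 0).
  apply: col2P; rewrite !mxE !big_ord_recl big_ord0 !mxE /= ?mulr0n ?mulr1n.
    by rewrite mul0r !addr0.
  by rewrite mul0r add0r addr0 lift1.
have D_unit : D \in unitmx.
  rewrite unitmxE /D /aniso_dilation map_diag_mx det_diag !big_ord_recl big_ord0.
  by rewrite !mxE /= mulr1 unitfE mulf_neq0 // pnatr_eq0.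
have DV (v : 'cV[R]_2) : invmx D *m v = vec2 (v 0 0 / 2%:R) (v 1 0 / m%:R).
  rewrite -[RHS](mulKmx D_unit) DE vec20 vec21; congr (_ *m _).
  by apply: col2P; rewrite ?vec20 ?vec21 mulrC divfK // pnatr_eq0.
elim: k => [|k IHk].
  by rewrite expr0 mul1mx; apply: col2P; rewrite !mxE /= !expn0 divr1.
rewrite exprS -mulmxA IHk DV !vec20 !vec21 !expnS !natrM !invfM.
by congr vec2; ring.
Qed.

Lemma refine_dilate k (alpha beta : Z2) :
  refine (R := R) (aniso_dilation m) k (alpha - dilate m k beta)
  = refine (R := R) (aniso_dilation m) k alpha - toR2 R beta.
Proof.
have k2 : (2 ^ k)%N%:R != 0 :> R by rewrite pnatr_eq0 expn_eq0.
have km : (m ^ k)%N%:R != 0 :> R by rewrite pnatr_eq0 expn_eq0; lia.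
rewrite !refineE; apply: col2P; rewrite !mxE /= rmorphB rmorphM /= mulrBl;
  by rewrite [_ * (beta _ _)%:~R]mulrC mulfK.
Qed.

(** The refined point of lattice_floor x k tends to x, which allows values of
    phi at x to be compared with values of the iterates on the lattice. *)
Definition lattice_floor (x : 'cV[R]_2) k : Z2 :=
  vec2 (Num.floor ((2 ^ k)%N%:R * x 0 0)) (Num.floor ((m ^ k)%N%:R * x 1 0)).

Lemma cvg_floor_ratio (b : nat) (t : R) : (1 < b)%N ->
  (fun k => (Num.floor ((b ^ k)%N%:R * t))%:~R / (b ^ k)%N%:R : R) @ \oo --> t.
Proof.
move=> b_gt1; apply/cvgrPdist_le => e e_gt0.
have geo : geometric 1 (b%:R^-1 : R) k @[k --> \oo] --> (0 : R).
  apply: cvg_geometric; rewrite ger0_norm ?invr_ge0 //.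
  by rewrite invf_lt1 ?ltr0n ?ltr1n //; lia.
move/cvgrPdist_le: geo => /(_ e e_gt0); apply: filterS => k.
rewrite /= sub0r normrN mul1r ger0_norm ?exprn_ge0 ?invr_ge0 // => bk.
have s_gt0 : 0 < (b ^ k)%N%:R :> R by rewrite ltr0n expn_gt0; lia.
apply: le_trans bk; rewrite exprVn -natrX.
set s := (b ^ k)%N%:R in s_gt0 *.
have := floor_le (s * t); have := lt_succ_floor (s * t).
set f := Num.floor _; rewrite rmorphD /= => fl fu.
have -> : t - f%:~R / s = (s * t - f%:~R) * s^-1.
  by rewrite mulrBl mulrAC divff ?mul1r // gt_eqF.
rewrite normrM [`|s^-1|]ger0_norm ?invr_ge0 ?(ltW s_gt0) // -[leRHS]mul1r.
rewrite ler_wpM2r ?invr_ge0 ?(ltW s_gt0) // ger0_norm ?subr_ge0 //.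
lra.
Qed.

End Refinement.

Section BasicLimit.
Variables (R : realType) (m N : nat) (a : Z2 -> R) (phi : 'cV[R]_2 -> R).
Hypothesis m_gt1 : (1 < m)%N.
Hypothesis a_supp : forall alpha, a alpha != 0 -> in_box N alpha.
Hypothesis phi_lim : is_basic_limit_function (aniso_dilation m) a phi.

Lemma basic_limit_cvg_seq (y : nat -> 'cV[R]_2) (x : 'cV[R]_2) :
  y k 0 0 @[k --> \oo] --> x 0 0 -> y k 1 0 @[k --> \oo] --> x 1 0 ->
  phi (y k) @[k --> \oo] --> phi x.
Proof.
move=> y0 y1; apply/cvgrPdist_lt => e e_gt0.
have [phi_uc _] := phi_lim.
have /phi_uc : entourage [set uv : R * R | ball uv.1 e uv.2].
  by rewrite -entourage_ballE; exists e.
rewrite /= /nbhs /= -entourage_ballE => -[d /= d_gt0 phi_d].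
have /cvgrPdist_lt/(_ _ d_gt0) y0d := y0.
have /cvgrPdist_lt/(_ _ d_gt0) y1d := y1.
near=> k; apply: (phi_d (x, y k)); split => //= i j.
rewrite (ord1 j).
have [->|->] : i = 0 \/ i = 1.
  by case: i => [[|[|i]] Hi] //; [left | right]; apply/val_inj.
  by near: k.
by near: k.
Unshelve. all: by end_near. Qed.

(** The point lattice_floor x k - M^k beta refines to a point that tends to
    x - beta, and phi differs from the k-th iterate there by at most a supremum
    that tends to 0. *)
Lemma basic_limit_cvg_cascade x beta :
  cascade m a k (lattice_floor m x k - dilate m k beta) @[k --> \oo]
    --> phi (x - toR2 R beta).
Proof.
have [_ /fine_cvgP[sup_fin sup_cvg]] := phi_lim.
pose y k := refine (R := R) (aniso_dilation m) k (lattice_floor m x k)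
            - toR2 R beta.
have phi_y : phi (y k) @[k --> \oo] --> phi (x - toR2 R beta).
  apply: basic_limit_cvg_seq.
    under eq_fun do rewrite /y refineE // !mxE /=.
    rewrite !mxE; apply: cvgB; last exact: cvg_cst.
    exact: cvg_floor_ratio.
  under eq_fun do rewrite /y refineE // !mxE /=.
  rewrite !mxE; apply: cvgB; last exact: cvg_cst.
  exact: cvg_floor_ratio.
have diff0 : phi (y k) - cascade m a k (lattice_floor m x k - dilate m k beta)
    @[k --> \oo] --> (0 : R).
  apply/cvgrPdist_lt => e e_gt0.
  move/cvgrPdist_lt: sup_cvg => /(_ _ e_gt0) sup_lt.
  near=> k; rewrite sub0r normrN.
  have supk : ereal_sup (range (fun alpha : Z2 =>
     `|phi (refine (aniso_dilation m) k alpha) - cascade m a k alpha|%:E))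
      \is a fin_num by near: k.
  have supk_lt : `|0 - fine (ereal_sup (range (fun alpha : Z2 =>
     `|phi (refine (aniso_dilation m) k alpha) - cascade m a k alpha|%:E)))| < e
     by near: k.
  apply: le_lt_trans supk_lt; rewrite sub0r normrN.
  apply: le_trans (ler_norm _); rewrite -lee_fin fineK //.
  apply: ereal_sup_ubound; exists (lattice_floor m x k - dilate m k beta) => //.
  by rewrite refine_dilate.
rewrite -[phi _]subr0 (_ : (fun k => _) = fun k => phi (y k) - (phi (y k)
    - cascade m a k (lattice_floor m x k - dilate m k beta))).
  exact: cvgB.
by apply/funext => k; ring.
Unshelve. all: by end_near. Qed.

Lemma lattice_floor_bound (C : nat) (x : 'cV[R]_2) k :
  `|x 0 0| <= C%:R -> `|x 1 0| <= C%:R ->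
  (absz (lattice_floor m x k 0%R 0%R) <= C * 2 ^ k)%N /\
  (absz (lattice_floor m x k 1%R 0%R) <= C * m ^ k)%N.
Proof.
have bound s (t : R) : `|t| <= C%:R ->
    (absz (Num.floor (s%:R * t)) <= C * s)%N.
  rewrite ler_norml => /andP[tl tu].
  have s_ge0 : 0 <= s%:R :> R by [].
  have lo : - (C * s)%N%:Z <= Num.floor (s%:R * t).
    rewrite floor_ge_int rmorphN /= PoszM rmorphM /= -mulNr mulrC.
    by rewrite ler_wpM2l.
  have up : Num.floor (s%:R * t) <= (C * s)%N%:Z.
    rewrite -(ler_int R); apply: le_trans (floor_le _) _.
    by rewrite PoszM rmorphM /= mulrC ler_wpM2r.
  by lia.
by move=> x0 x1; rewrite /lattice_floor vec20 vec21; split; apply: bound.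
Qed.

(** In units of M^k the iterate lives in the box of size N, and the refined point
    stays within C of the origin: the box of relevant beta does not depend on k. *)
Lemma cascade_lattice_floor_eq0 (C : nat) (x : 'cV[R]_2) beta k :
  `|x 0 0| <= C%:R -> `|x 1 0| <= C%:R -> ~~ in_box (C + N) beta ->
  cascade m a k (lattice_floor m x k - dilate m k beta) = 0.
Proof.
move=> x0 x1; apply: contraNeq.
have [f0 f1] := lattice_floor_bound k x0 x1.
move=> /(cascade_supp m_gt1 a_supp); rewrite !mxE /= => -[c0 c1].
move: f0 f1; rewrite !mxE /= => f0 f1.
have k2 : (0 < 2 ^ k)%N by rewrite expn_gt0.
have km : (0 < m ^ k)%N by rewrite expn_gt0; lia.
apply/andP; split.
  exact: (quotient_bound k2 f0 (leq_trans (leq_addr _ _) c0)).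
exact: (quotient_bound km f1 (leq_trans (leq_addr _ _) c1)).
Qed.

Lemma basic_limit_box (C : nat) (x : 'cV[R]_2) beta :
  `|x 0 0| <= C%:R -> `|x 1 0| <= C%:R -> ~~ in_box (C + N) beta ->
  phi (x - toR2 R beta) = 0.
Proof.
move=> x0 x1 betaN; have := @basic_limit_cvg_cascade x beta.
under eq_fun do rewrite (cascade_lattice_floor_eq0 _ x0 x1 betaN).
by move=> lim0; apply: (norm_cvg_unique lim0); exact: cvg_cst.
Qed.

Lemma basic_limit_monomial (C : nat) (x : 'cV[R]_2) i j :
  `|x 0 0| <= C%:R -> `|x 1 0| <= C%:R ->
  refines_monomial m a i j ->
  \sum_(beta <- box (C + N))
     phi (x - toR2 R beta) * ((beta 0 0)%:~R ^+ i * (beta 1 0)%:~R ^+ j)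
  = x 0 0 ^+ i * x 1 0 ^+ j.
Proof.
move=> x0 x1 a_monomial.
have lhs : (fun k => \sum_(beta <- box (C + N))
      cascade m a k (lattice_floor m x k - dilate m k beta)
        * ((beta 0 0)%:~R ^+ i * (beta 1 0)%:~R ^+ j)) @ \oo -->
    \sum_(beta <- box (C + N))
      phi (x - toR2 R beta) * ((beta 0 0)%:~R ^+ i * (beta 1 0)%:~R ^+ j).
  apply: cvg_big => [|beta _]; first exact: add_continuous.
  by apply: cvgMl; exact: basic_limit_cvg_cascade.
have sumE k : \sum_(beta <- box (C + N))
      cascade m a k (lattice_floor m x k - dilate m k beta)
        * ((beta 0 0)%:~R ^+ i * (beta 1 0)%:~R ^+ j)
    = ((lattice_floor m x k 0 0)%:~R / (2 ^ k)%N%:R) ^+ i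
      * ((lattice_floor m x k 1 0)%:~R / (m ^ k)%N%:R) ^+ j.
  rewrite -(cascade_monomial m_gt1 a_supp _ _ a_monomial); apply/esym/fsumT_box.
  by move=> beta betaN; rewrite (cascade_lattice_floor_eq0 _ x0 x1 betaN) mul0r.
move: lhs; under eq_fun do rewrite sumE; move=> lhs.
have floor0 : (lattice_floor m x k 0 0)%:~R / (2 ^ k)%N%:R @[k --> \oo] --> x 0 0.
  by under eq_fun do rewrite vec20; exact: cvg_floor_ratio.
have floor1 : (lattice_floor m x k 1 0)%:~R / (m ^ k)%N%:R @[k --> \oo] --> x 1 0.
  by under eq_fun do rewrite vec21; exact: cvg_floor_ratio.
apply: norm_cvg_unique lhs (cvgM _ _).
  exact: continuous_cvg (@exprn_continuous R i _) floor0.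
exact: continuous_cvg (@exprn_continuous R j _) floor1.
Qed.

(** Monomials suffice by linearity; the box depends on x only, so the sum is
    finite and may be exchanged with the expansion of the polynomial. *)
Lemma basic_limit_reproduces_polynomials D :
  (forall i j, (i + j <= D)%N -> refines_monomial m a i j) ->
  reproduces_polynomials (aniso_dilation m) a D.
Proof.
move=> a_monomial; exists phi => // q q_deg x.
have lift1 : lift ord0 ord0 = 1 :> 'I_2 by apply/val_inj.
pose C := Num.bound (`|x 0 0| + `|x 1 0|).
have xC : `|x 0 0| + `|x 1 0| <= C%:R.
  by apply/ltW/archi_boundP; rewrite addr_ge0.
have x0 : `|x 0 0| <= C%:R by apply: le_trans xC; rewrite lerDl.
have x1 : `|x 1 0| <= C%:R by apply: le_trans xC; rewrite lerDr.
rewrite (fsumT_box (N := C + N)) => [|beta betaN]; last first.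
  by rewrite (basic_limit_box x0 x1 betaN) mulr0.
under eq_bigr do rewrite /eval2 mpoly.mevalE mulr_suml.
rewrite exchange_big /= /eval2 mpoly.mevalE.
rewrite big_seq [RHS]big_seq; apply: eq_bigr => mu mu_q.
have mu_deg : (mpoly.fun_of_multinom mu 0%R + mpoly.fun_of_multinom mu 1%R <= D)%N.
  have := leq_trans (mpoly.msize_mdeg_lt mu_q) q_deg.
  by rewrite mpoly.mdegE big_ord_recl big_ord1 lift1 ltnS.
have monoE (y : 'cV[R]_2) : \prod_i y i 0 ^+ mpoly.fun_of_multinom mu i =
    y 0 0 ^+ mpoly.fun_of_multinom mu 0 * y 1 0 ^+ mpoly.fun_of_multinom mu 1.
  by rewrite big_ord_recl big_ord1 lift1.
rewrite monoE -(basic_limit_monomial x0 x1 (a_monomial _ _ mu_deg)) mulr_sumr.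
apply: eq_bigr => beta _; rewrite monoE !mxE -!mulrA; congr (_ * _).
by ring.
Qed.

End BasicLimit.

Theorem theorem3p8 (R : realType) (m n : nat)
  (m_ge3 : (3 <= m)%N) (m_odd : odd m) (n_ge1 : (1 <= n)%N) :
  let M := aniso_dilation m in
  let a := aniso_mask R m n in
  [/\ mask_support a `<=`
        [set alpha : Z2 | m%:Z * `|alpha 0 0| + 2 * `|alpha 1 0|
                            <= 2 * m%:Z * n%:Z - 2 + m%:Z]
      /\ mask_support a `<=`
        [set alpha : Z2 | 1 - 2 * n%:Z <= alpha 0 0 <= 2 * n%:Z - 1 /\
                          1 - m%:Z * n%:Z <= alpha 1 0 <= m%:Z * n%:Z - 1],
      forall alpha1 alpha2 : int,
        [/\ a (vec2 alpha1 alpha2) = a (vec2 alpha1 (- alpha2)),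
            a (vec2 alpha1 alpha2) = a (vec2 (- alpha1) alpha2) &
            a (vec2 alpha1 alpha2) = a (vec2 (- alpha1) (- alpha2))]
    & convergent_scheme M a -> reproduces_polynomials M a (2 * n - 1)].
Proof.
move=> M a; have m_gt1 : (1 < m)%N by exact: ltnW.
have aE : a = aniso_coef R m n by exact: aniso_maskE.
have supp alpha : mask_support a alpha -> exists p q,
    [/\ (0 < p <= n)%N, (0 < q <= n)%N, (p + q <= n.+1)%N,
        (absz (alpha 0%R 0%R) < 2 * p)%N & (absz (alpha 1%R 0%R) < m * q)%N].
  by rewrite /mask_support /= aE; exact: aniso_coef_supp.
split.
- split => alpha /supp[p [q [pn qn pq a0 a1]]] /=.
    have : (m * absz (alpha 0%R 0%R) <= m * (2 * p - 1))%N.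
      by rewrite leq_mul2l; lia.
    have : (m * (p + q) <= m * n.+1)%N by rewrite leq_mul2l; lia.
    rewrite -!abszE; nia.
  have : (m * q <= m * n)%N by rewrite leq_mul2l; lia.
  by split; nia.
- move=> alpha1 alpha2; rewrite aE /aniso_coef !vec20 !vec21.
  by split; congr (_ - _); apply: eq_bigr => k _; rewrite ?dd_mask_sym.
- have delta_bounded : bounded_fun (@delta R).
    exists 1; split=> // C C_gt1 alpha _; apply: le_trans (ltW C_gt1).
    by rewrite /delta; case: eqP => _; rewrite ?normr1 ?normr0.
  move=> /(_ _ delta_bounded)[phi phi_lim]; rewrite aE in phi_lim *.
  apply: (basic_limit_reproduces_polynomials m_gt1 _ phi_lim (N := 2 * n + m * n)).
    by move=> alpha; apply: contraNT => /(aniso_coef_box R m_gt1) ->.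
  by move=> i j ij alpha; apply: aniso_coef_monomial; lia.
Qed.
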